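(* Let $\perp^{0}$ be an invariant relation satisfying right monotonicity, right base monotonicity and local character. Let $\perp$ be an invariant relation satisfying left and right monotonicity and the following property ($\perp^0$-amalgamation over models): for every small model $M$ and small tuples $a,b,c_1,c_2$, if $c_1\equiv_M c_2$, $c_1\perp_M a$, $c_2\perp_M b$ and $a\perp^{0}_M b$, then there exists $c$ with $c\perp_M ab$, $c\equiv_{Ma}c_1$ and $c\equiv_{Mb}c_2$. Then $(\perp^{M})^{*}\to\perp^{f}$, i.e. for all small $A,B,C$, $A\,(\perp^{M})^{*}_C\,B$ implies $A\perp^{f}_C B$.
   Context: Setting. $T$ is a complete first-order theory with only infinite models in an at most countable language $L$. $\mathbb M$ is a monster model of $T$: for a fixed big enough cardinal $\bar\kappa$ (e.g. strongly inaccessible), $\mathbb M$ is $\bar\kappa^+$-universal, $\bar\kappa$-saturated and strongly $\bar\kappa$-homogeneous. ''Small'' means of cardinality $<\bar\kappa$; all sets and (possibly infinite) tuples of $\mathbb M$ considered are small; a small model is a small elementary substructure of $\mathbb M$. Juxtaposition denotes union; a tuple in place of a set stands for the set of its coordinates. $a\equiv_C b$ means $\mathrm{tp}(a/C)=\mathrm{tp}(b/C)$; $A\equiv_C B$ for sets means $\sigma(A)=B$ for some $\sigma\in \mathrm{Aut}(\mathbb M/C)$. A ternary relation $\perp$ on small subsets is invariant if $A\perp_C B\iff \sigma(A)\perp_{\sigma(C)}\sigma(B)$ for all $\sigma\in\mathrm{Aut}(\mathbb M)$. Axioms. - Right monotonicity: $A\perp_C BD\Rightarrow A\perp_C B$.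 Left monotonicity: $AD\perp_C B\Rightarrow A\perp_C B$. - Right base monotonicity: if $C\subseteq B\subseteq D$ and $A\perp_C D$ then $A\perp_B D$. - Local character: for all $A$ there is a (small) cardinal $\kappa=\kappa(A)$ such that for all $B$ there is $B_0\subseteq B$ with $|B_0|<\kappa$ and $A\perp_{B_0}B$. Derived relations. The monotonisation $\perp^{M}$ of $\perp$ (the superscript $M$ is just notation, unrelated to models) is defined by: $A\perp^{M}_C B$ iff $A\perp_X B$ for all $X$ with $C\subseteq X\subseteq \mathrm{acl}(BC)$, where $\mathrm{acl}$ is the model-theoretic algebraic closure. For a relation $\perp$, $A\perp^{*}_C B$ iff for all $D\supseteq B$ there is $A'\equiv_{BC}A$ with $A'\perp_C D$. $(\perp^M)^*$ is obtained by applying $*$ to $\perp^M$. Forking. A formula $\phi(x,b)$ divides over $C$ if for some $k$ there is a sequence $(b_i)_{i<\omega}$ of realisations of $\mathrm{tp}(b/C)$ such that $\{\phi(x,b_i):i<\omega\}$ is $k$-inconsistent. A formula forks over $C$ if it implies a finite disjunction of formulas each of which divides over $C$; a partial type forks over $C$ if it implies a formula that forks over $C$. $A\perp^{f}_C B$ means that $\mathrm{tp}(A/BC)$ does not fork over $C$. *)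

(* Defs.v *)
From mathcomp Require Import all_boot.
From mathcomp Require Import boolp classical_sets functions cardinality.

Set Implicit Arguments.
Unset Strict Implicit.
Unset Printing Implicit Defensive.

Local Open Scope classical_set_scope.
Local Open Scope card_scope.

Record language := Language {
  fsym : Type;
  farity : fsym -> nat;
  rsym : Type;
  rarity : rsym -> nat }.

Definition countable_language (L : language) : Prop :=
  countable [set: fsym L] /\ countable [set: rsym L].

(* [term L n] and [formula L n]: terms and formulas whose free variables are
   indexed by ['I_n]. *)
Inductive term (L : language) (n : nat) : Type :=
| Var of 'I_n
| App (f : fsym L) of ('I_(farity f) -> term L n).

(* [All] binds the variable [ord0] of its body; the variable [i] of the
   quantified formula is the variable [lift ord0 i] of the body. *)
Inductive formula (L : language) : nat -> Type :=
| Bot n : formula L n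
| Equal n : term L n -> term L n -> formula L n
| Rel n (r : rsym L) : ('I_(rarity r) -> term L n) -> formula L n
| Imp n : formula L n -> formula L n -> formula L n
| All n : formula L n.+1 -> formula L n.
Arguments Bot {L n}.
Arguments Rel {L n} r _.

Definition sentence (L : language) := formula L 0.

Record structure (L : language) := Structure {
  carrier :> Type;
  carrier_inhabited : inhabited carrier;
  fun_of : forall f : fsym L, ('I_(farity f) -> carrier) -> carrier;
  rel_of : forall r : rsym L, ('I_(rarity r) -> carrier) -> Prop }.
Arguments fun_of {L} s f _.
Arguments rel_of {L} s r _.

Fixpoint eval (L : language) (S : structure L) n (v : 'I_n -> S)
    (t : term L n) : S :=
  match t with
  | Var i => v i
  | App f ts => fun_of S f (fun i => eval v (ts i))
  end.

Definition val_cons (X : Type) n (x : X) (v : 'I_n -> X) : 'I_n.+1 -> X :=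
  fun i => if unlift ord0 i is Some j then v j else x.

Definition val_cat (X : Type) m n (v : 'I_m -> X) (w : 'I_n -> X) :
    'I_(m + n) -> X :=
  fun i => match fintype.split i with inl j => v j | inr j => w j end.

Fixpoint sat (L : language) (S : structure L) n (phi : formula L n) :
    ('I_n -> S) -> Prop :=
  match phi in formula _ n return ('I_n -> S) -> Prop with
  | Bot _ => fun _ => False
  | Equal _ t u => fun v => eval v t = eval v u
  | Rel _ r ts => fun v => rel_of S r (fun i => eval v (ts i))
  | Imp _ p q => fun v => sat p v -> sat q v
  | All _ p => fun v => forall x : S, sat p (val_cons x v)
  end.

Definition holds (L : language) (S : structure L) (phi : sentence L) : Prop :=
  forall v : 'I_0 -> S, sat phi v.

Definition is_model (L : language) (T : set (sentence L)) (S : structure L) :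
    Prop :=
  forall phi, T phi -> holds S phi.

Definition consequence (L : language) (T : set (sentence L))
    (phi : sentence L) : Prop :=
  forall S : structure L, is_model T S -> holds S phi.

Definition complete_theory (L : language) (T : set (sentence L)) : Prop :=
  (exists S : structure L, is_model T S) /\
  forall phi : sentence L, consequence T phi \/ consequence T (Imp phi Bot).

Definition only_infinite_models (L : language) (T : set (sentence L)) : Prop :=
  forall S : structure L, is_model T S -> infinite_set [set: S].

Definition elementary_embedding (L : language) (S S' : structure L)
    (h : S -> S') : Prop :=
  forall n (phi : formula L n) (v : 'I_n -> S), sat phi v <-> sat phi (h \o v).

Definition fun_closed (L : language) (S : structure L) (N : set S) : Prop :=
  forall (f : fsym L) (v : 'I_(farity f) -> S),
    (forall i, N (v i)) -> N (fun_of S f v).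

Lemma sub_inhabited (X : Type) (N : set X) : N !=set0 -> inhabited N.
Proof. by case=> x Nx; exists; exists x; rewrite inE. Qed.

Lemma fun_closed_mem (L : language) (S : structure L) (N : set S)
    (Nf : fun_closed N) (f : fsym L) (v : 'I_(farity f) -> N) :
  fun_of S f (val \o v) \in N.
Proof. by rewrite inE; apply: Nf => i; apply/set_mem/(valP (v i)). Qed.

Definition substructure (L : language) (S : structure L) (N : set S)
    (N0 : N !=set0) (Nf : fun_closed N) : structure L :=
  @Structure L N (sub_inhabited N0)
    (fun f v => exist _ (fun_of S f (val \o v)) (fun_closed_mem Nf v))
    (fun r v => rel_of S r (val \o v)).

Definition elementary_substructure (L : language) (S : structure L)
    (N : set S) : Prop :=
  exists (N0 : N !=set0) (Nf : fun_closed N),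
    @elementary_embedding L (substructure N0 Nf) S val.

Definition automorphism (L : language) (S : structure L) (s : S -> S) : Prop :=
  [/\ bijective s,
      forall f v, s (fun_of S f v) = fun_of S f (s \o v) &
      forall r v, rel_of S r v <-> rel_of S r (s \o v)].

Definition automorphism_over (L : language) (S : structure L) (C : set S)
    (s : S -> S) : Prop :=
  automorphism s /\ forall c, C c -> s c = c.

(* [pformula L I]: a partitioned formula phi(x, y), where x is a finite tuple
   of variables taken from a family indexed by an arbitrary type [I], and y is
   a tuple of [npar] parameter variables. *)
Record pformula (L : language) (I : Type) := PFormula {
  nvar : nat;
  npar : nat;
  matrix : formula L (nvar + npar);
  vars : 'I_nvar -> I }.

Definition psat (L : language) (S : structure L) (I : Type)
    (p : pformula L I) (x : I -> S) (b : 'I_(npar p) -> S) : Prop :=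
  sat (matrix p) (val_cat (x \o @vars _ _ p) b).

(* [iformula S I]: an instance phi(x, b) of such a formula, b in S. *)
Record iformula (L : language) (S : structure L) (I : Type) := IFormula {
  pform : pformula L I;
  params : 'I_(npar pform) -> S }.

Definition isat (L : language) (S : structure L) (I : Type)
    (q : iformula S I) (x : I -> S) : Prop :=
  psat x (@params _ _ _ q).

Definition over (L : language) (S : structure L) (I : Type) (C : set S)
    (q : iformula S I) : Prop :=
  forall j, C (@params _ _ _ q j).

Definition tp (L : language) (S : structure L) (I : Type) (a : I -> S)
    (C : set S) : set (iformula S I) :=
  [set q | over C q /\ isat q a].

Definition realises (L : language) (S : structure L) (I : Type)
    (p : set (iformula S I)) (a : I -> S) : Prop :=
  forall q, p q -> isat q a.

Definition acl (L : language) (S : structure L) (C : set S) : set S :=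
  [set a | exists q : iformula S unit,
     [/\ over C q, isat q (fun=> a) &
         finite_set [set x : S | isat q (fun=> x)]]].

Definition card_lt (X Y : Type) (A : set X) (B : set Y) : Prop :=
  A #<= B /\ ~ (B #<= A).

(* A cardinal is given as the cardinality of a type [K]; the cardinals below it
   are then the cardinalities [X] of subsets of [K] with
   [card_lt X [set: K]]. *)
Definition small (K X : Type) (A : set X) : Prop := card_lt A [set: K].

Definition strongly_inaccessible (K : Type) : Prop :=
  [/\ ~ countable [set: K],
      forall X : set K, small K X -> small K [set Y : set K | Y `<=` X] &
      forall (X : set K) (F : K -> set K), small K X ->
        (forall i, X i -> small K (F i)) -> small K (\bigcup_(i in X) F i)].

Definition succ_universal (L : language) (T : set (sentence L)) (K : Type)
    (S : structure L) : Prop :=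
  forall N : structure L, is_model T N -> [set: N] #<= [set: K] ->
    exists h : N -> S, elementary_embedding h.

Definition saturated (L : language) (K : Type) (S : structure L) : Prop :=
  forall (C : set S) (p : set (iformula S unit)), small K C ->
    (forall q, p q -> over C q) ->
    (forall p0 : set (iformula S unit), p0 `<=` p -> finite_set p0 ->
       exists x, realises p0 x) ->
    exists x, realises p x.

Definition partial_elementary (L : language) (S : structure L) (A : set S)
    (h : S -> S) : Prop :=
  forall n (phi : formula L n) (v : 'I_n -> S), (forall i, A (v i)) ->
    (sat phi v <-> sat phi (h \o v)).

Definition strongly_homogeneous (L : language) (K : Type) (S : structure L) :
    Prop :=
  forall (A : set S) (h : S -> S), small K A -> partial_elementary A h ->
    exists s, automorphism s /\ forall a, A a -> s a = h a.

Definition monster_model (L : language) (T : set (sentence L)) (K : Type)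
    (U : structure L) : Prop :=
  [/\ is_model T U, succ_universal T K U, saturated K U &
      strongly_homogeneous K U].

Definition small_model (L : language) (K : Type) (U : structure L)
    (N : set U) : Prop :=
  small K N /\ elementary_substructure N.

(* A ≡_C B for sets: no enumerations of A and B are fixed. *)
Definition set_equiv (L : language) (U : structure L) (C A B : set U) : Prop :=
  exists s, automorphism_over C s /\ s @` A = B.

(* [R A C B] reads A ⫝_C B, the base being the middle argument. The values of
   [R] at sets which are not small are irrelevant. *)
Definition indep_relation (L : language) (U : structure L) :=
  set U -> set U -> set U -> Prop.

Definition invariant_relation (L : language) (K : Type) (U : structure L)
    (R : indep_relation U) : Prop :=
  forall A C B : set U, small K A -> small K C -> small K B ->
  forall s, automorphism s -> (R A C B <-> R (s @` A) (s @` C) (s @` B)).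

Definition right_monotonicity (L : language) (K : Type) (U : structure L)
    (R : indep_relation U) : Prop :=
  forall A C B D : set U, small K A -> small K C -> small K B -> small K D ->
    R A C (B `|` D) -> R A C B.

Definition left_monotonicity (L : language) (K : Type) (U : structure L)
    (R : indep_relation U) : Prop :=
  forall A C B D : set U, small K A -> small K C -> small K B -> small K D ->
    R (A `|` D) C B -> R A C B.

Definition right_base_monotonicity (L : language) (K : Type) (U : structure L)
    (R : indep_relation U) : Prop :=
  forall A C B D : set U, small K A -> small K C -> small K B -> small K D ->
    C `<=` B -> B `<=` D -> R A C D -> R A B D.

Definition local_character (L : language) (K : Type) (U : structure L)
    (R : indep_relation U) : Prop :=
  forall A : set U, small K A ->
  exists kappa : set K, small K kappa /\
    forall B : set U, small K B ->
    exists B0 : set U, [/\ B0 `<=` B, card_lt B0 kappa & R A B0 B].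

(* Small tuples are families indexed by an arbitrary small type. *)
Definition amalgamation_over_models (L : language) (K : Type) (U : structure L)
    (R0 R : indep_relation U) : Prop :=
  forall (M : set U) (I J H : Type) (a : I -> U) (b : J -> U)
    (c1 c2 : H -> U),
    small_model K M ->
    small K [set: I] -> small K [set: J] -> small K [set: H] ->
    tp c1 M = tp c2 M ->
    R (range c1) M (range a) -> R (range c2) M (range b) ->
    R0 (range a) M (range b) ->
    exists c : H -> U,
      [/\ R (range c) M (range a `|` range b),
          tp c (M `|` range a) = tp c1 (M `|` range a) &
          tp c (M `|` range b) = tp c2 (M `|` range b)].

Definition monotonisation (L : language) (U : structure L)
    (R : indep_relation U) : indep_relation U :=
  fun A C B => forall X : set U,
    C `<=` X -> X `<=` acl (B `|` C) -> R A X B.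

Definition star (L : language) (K : Type) (U : structure L)
    (R : indep_relation U) : indep_relation U :=
  fun A C B => forall D : set U, small K D -> B `<=` D ->
    exists A' : set U, set_equiv (B `|` C) A' A /\ R A' C D.

(* Inconsistency refers to sub-families of k distinct indices, so that
   repetitions in the sequence count. *)
Definition k_inconsistent (L : language) (U : structure L) (I : Type)
    (p : pformula L I) (k : nat) (b : nat -> 'I_(npar p) -> U) : Prop :=
  forall s : 'I_k -> nat, injective s ->
    ~ exists x : I -> U, forall j, psat x (b (s j)).

Definition divides (L : language) (U : structure L) (I : Type) (C : set U)
    (q : iformula U I) : Prop :=
  exists (k : nat) (b : nat -> 'I_(npar (pform q)) -> U),
    (forall i, realises (tp (@params _ _ _ q) C) (b i)) /\ k_inconsistent k b.

Definition forks (L : language) (U : structure L) (I : Type) (C : set U)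
    (q : iformula U I) : Prop :=
  exists (n : nat) (r : 'I_n -> iformula U I),
    (forall x, isat q x -> exists l, isat (r l) x) /\
    forall l, divides C (r l).

(* In a monster model, a partial type over a small set implies a formula iff
   its realisations in the model satisfy that formula. *)
Definition type_forks (L : language) (U : structure L) (I : Type) (C : set U)
    (p : set (iformula U I)) : Prop :=
  exists q : iformula U I,
    (forall x, realises p x -> isat q x) /\ forks C q.

(* tp(A/BC) is the type of the enumeration of A by itself. *)
Definition nonforking (L : language) (U : structure L) : indep_relation U :=
  fun A C B => ~ type_forks C (tp (val : A -> U) (B `|` C)).

(* Main.v *)
Require Import Defs.
From mathcomp Require Import all_boot.
From mathcomp Require Import boolp classical_sets functions cardinality filter.

Set Implicit Arguments.
Unset Strict Implicit.
Unset Printing Implicit Defensive.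

Local Open Scope classical_set_scope.
Local Open Scope card_scope.

(** Suppose that tp(A/BC) forks over C, so that it implies a finite disjunction
    of formulas phi_l(x,b_l), each dividing over C. For each l a Morley-like
    sequence is built that witnesses dividing and is independent for R0 over a
    model: there are a small model M containing C and tuples e_0, e_1, ... such
    that e_0 is conjugate to b_l over C, all e_j are conjugate over M, e_j is
    R0-independent from e_0 ... e_(j-1) over M, and finitely many of the
    phi_l(x,e_j) are already inconsistent (dividing_sequence). Move everything
    by an automorphism over C so that e_0 = b_l, and let D contain B, C and, for
    every l, the model and b_l. By definition of the star relation some
    conjugate A' of A over BC is R-independent from D over every set between C
    and acl(CD), hence over each of the models. An enumeration of A' satisfies
    some phi_l(x,b_l). Its conjugates over M satisfy phi_l(x,e_j) and are
    R-independent from e_j over M, so amalgamation over M, used once for each j,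
    produces one tuple satisfying phi_l(x,e_j) for as many j as desired
    (amalgamate_sequence): a contradiction.

    The sequence is obtained without indiscernibles. Let (b_i) witness that
    phi(x,b) divides over C, fix a free ultrafilter on nat and consider the
    limit type p of the b_i over the whole monster, that is, the formulas true
    of b_i for almost all i. Each restriction of p to a small set is realised
    (limit_exists). Suppose that e_j realises p over a set M_j containing all b_i
    and all earlier e_i. Then, starting with the last, the e_j can be replaced by
    suitable b_i without losing consistency of the instances of phi, so those
    instances are as inconsistent as the original ones (limit_inconsistent).

    For R0-independence (independent_chain), let d0 realise p over the empty set
    and let kappa be the cardinal given by local character for d0; by invariance
    it serves every realisation of p. Index small models M_t by the well-founded
    trees t with kappa-branching nodes, M_t containing M_u and a realisation e_u
    of p over M_u for every child u of t. Trees make this family directed under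
    kappa members at a time, with no cardinal arithmetic: the union B of the M_t
    is small, and a subset B0 of B with at most kappa elements lies in a single
    M_t. If d realises p over B and is R0-independent from B over such a B0, base
    monotonicity replaces B0 by M = M_t. Going up from t through trees with
    constant children gives e_0, e_1, ... in B with e_j and d of the same type
    over M, e_0, ..., e_(j-1), so the independence of d passes to e_j by
    invariance. Keeping the earlier terms on the right of R0 is what makes right
    monotonicity and local character for a single finite tuple sufficient. *)

(** * Smallness under an inaccessible cardinal *)

Lemma card_le_set_inj (X Y : Type) (y0 : Y) (A : set X) (B : set Y) :
  A #<= B -> exists f : X -> Y,
    (forall x, A x -> B (f x)) /\
    (forall x x', A x -> A x' -> f x = f x' -> x = x').
Proof.
case/card_leP=> f.
exists (fun x => if pselect (A x) is left Ax then val (f (exist _ x (mem_set Ax)))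
                 else y0); split=> [x Ax|x x' Ax Ax'].
  by case: pselect => // Ax1; apply/set_mem/(valP (f _)).
case: pselect => // Bx; case: pselect => // Bx' /val_inj e.
have inj : set_inj [set: A] f by exact: inj.
by have /(congr1 val) := inj _ _ (mem_set I) (mem_set I) e.
Qed.

Lemma set_inj_card_le (X Y : Type) (A : set X) (B : set Y) (f : X -> Y) :
  (forall x, A x -> B (f x)) ->
  (forall x x', A x -> A x' -> f x = f x' -> x = x') -> A #<= B.
Proof.
move=> fAB finj.
have fA : {in A &, injective f} by move=> x y /set_mem Ax /set_mem Ay; exact: finj.
rewrite -(card_le_eql (inj_card_eq fA)); apply: subset_card_le => _ [x Ax <-].
exact: fAB.
Qed.

Section Small.
Variable K : Type.
Hypothesis Kin : strongly_inaccessible K.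

Lemma small_le (X Y : Type) (A : set X) (B : set Y) :
  A #<= B -> small K B -> small K A.
Proof.
move=> AB [BK nKB]; split; first exact: card_le_trans AB BK.
by move=> KA; apply: nKB; exact: card_le_trans KA AB.
Qed.

Lemma small_sub (X : Type) (A B : set X) : A `<=` B -> small K B -> small K A.
Proof. by move/subset_card_le; exact: small_le. Qed.

Lemma small_image (X Y : Type) (f : X -> Y) (A : set X) :
  small K A -> small K (f @` A).
Proof. exact/small_le/card_image_le. Qed.

Lemma small_range (X Y : Type) (f : X -> Y) :
  small K [set: X] -> small K (range f).
Proof. exact: small_image. Qed.

Lemma small_setT (X : Type) (A : set X) : small K A -> small K [set: A].
Proof. by apply: small_le; move: (card_setT A); rewrite card_eq_le => /andP[]. Qed.

Lemma nat_in_K : [set: nat] #<= [set: K].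
Proof.
have [nK _ _] := Kin; apply/(infiniteP [set: K]) => fK.
by apply: nK; exact: finite_set_countable.
Qed.

Lemma small_countable (X : Type) (A : set X) : countable A -> small K A.
Proof.
move=> cA; apply: (small_le cA); split; first exact: nat_in_K.
by case: Kin.
Qed.

Lemma small_finite (X : Type) (A : set X) : finite_set A -> small K A.
Proof. by move/finite_set_countable/small_countable. Qed.

Lemma small_inj (X : Type) (A : set X) : small K A ->
  exists f : X -> K, forall x x', A x -> A x' -> f x = f x' -> x = x'.
Proof.
have [k] : inhabited K.
  apply: contrapT => nK; case: Kin => + _ _; apply.
  suff -> : [set: K] = set0 by exact: countable0.
  by apply/seteqP; split=> // k _; case: nK.
by case=> AK _; case: (card_le_set_inj k AK) => f [_ fi]; exists f.
Qed.

Lemma small_powerset (X : Type) (A : set X) :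
  small K A -> small K [set Y : set X | Y `<=` A].
Proof.
move=> sA; have [f fi] := small_inj sA.
have [_ pow _] := Kin.
apply: small_le (pow _ (small_image f sA)).
apply: (@set_inj_card_le _ _ _ _ (fun Y => f @` Y)) => [Y YA|Y Z YA ZA e].
  by move=> _ [x Yx <-]; exists x => //; exact: YA.
wlog suff: Y Z YA ZA e / Y `<=` Z; first by move=> H; apply/seteqP; split; exact: H.
move=> x Yx; have : (f @` Z) (f x) by rewrite -e; exists x.
by case=> z Zz /fi <- //; [exact: ZA | exact: YA].
Qed.

(** Only sets of elements of K are covered by the union axiom. This instance,
    indexed by two elements of K, is needed before products, and products are
    needed before unions of small families in other types. *)
Lemma small_setU_K (X Y : set K) : small K X -> small K Y -> small K (X `|` Y).
Proof.
move=> sX sY; have [iota [_ iinj]] : exists i : nat -> K, True /\ injective i.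
  have [f fi] := small_inj (small_countable (countableP [set: nat])).
  by exists f; split=> // x y; exact: fi.
have [_ _ cup] := Kin.
have := cup (iota @` [set: bool]) (fun k => if pselect (k = iota 0) then X else Y).
move=> /(_ (small_image _ (small_finite finite_finset))) cup'.
apply: small_sub (cup' _); last by move=> k _; case: pselect.
move=> x [Xx|Yx]; [exists (iota 0)|exists (iota 1)].
- by exists false.
- by case: pselect.
- by exists true.
- by case: pselect => // e; have := iinj _ _ e.
Qed.

(** Kuratowski pairs embed the product into a double powerset. *)
Lemma small_setX (S T : Type) (A : set S) (B : set T) :
  small K A -> small K B -> small K (A `*` B).
Proof.
move=> sA sB; have [f fi] := small_inj sA; have [g gi] := small_inj sB.
have sZ := small_setU_K (small_image f sA) (small_image g sB).
apply: small_le (small_powerset (small_powerset sZ)).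
pose pair x y : set (set K) := [set V | V = [set x] \/ V = [set x; y]].
have pair_inj x y x' y' : pair x y = pair x' y' -> x = x' /\ y = y'.
  move=> e.
  have exx' : x = x'.
    have : pair x' y' [set x] by rewrite -e; left.
    by case=> e'; have : [set x] x' by rewrite e' /=; auto.
  subst x'; split=> //.
  have h : [set x; y'] y.
    have : pair x y' [set x; y] by rewrite -e; right.
    have : [set x; y] y by right.
    by move=> yy [] e'; move: yy; rewrite e' //; left.
  have h' : [set x; y] y'.
    have : pair x y [set x; y'] by rewrite e; right.
    have : [set x; y'] y' by right.
    by move=> yy [] e'; move: yy; rewrite e' //; left.
  case: h => /= [yx|//]; case: h' => /= [y'x|//].
  by rewrite yx y'x.
apply: (@set_inj_card_le _ _ _ _ (fun p => pair (f p.1) (g p.2))).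
  move=> [s t] [/= As Bt] V [] -> k /=.
    by move=> ->; left; exists s.
  by case=> ->; [left; exists s|right; exists t].
move=> [s t] [s' t'] [/= As Bt] [/= As' Bt'] /pair_inj[/fi ef /gi eg].
by rewrite ef // eg.
Qed.

(** Sending x to an index i with x in F i, together with the image of x under
    an injection of F i into K, embeds the union into a product of small sets. *)
Lemma small_bigcup (I X : Type) (D : set I) (F : I -> set X) :
  small K D -> (forall i, D i -> small K (F i)) ->
  small K (\bigcup_(i in D) F i).
Proof.
move=> sD sF; have [f fi] := small_inj sD.
have /choice[g gi] : forall i, exists g : X -> K, D i ->
    forall x x', F i x -> F i x' -> g x = g x' -> x = x'.
  move=> i; case: (pselect (D i)) => Di.
    by have [g gi] := small_inj (sF i Di); exists g.
  by have [g _] := small_inj (small_finite (@finite_set0 X)); exists g.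
have [_ _ cup] := Kin.
pose G k := [set y | exists i x, [/\ D i, f i = k, F i x & g i x = y]].
have sG : small K (\bigcup_(k in f @` D) G k).
  apply: cup => [|_ [i Di <-]]; first exact: small_image.
  apply: small_sub (small_image (g i) (sF i Di)) => y [j [x [Dj /fi e Fx <-]]].
  by exists x => //; rewrite -e.
case: (pselect (exists i, D i)) => [[i0 _]|nD]; last first.
  apply: small_sub (small_finite (@finite_set0 X)) => x [i Di _].
  by case: nD; exists i.
have /choice[c cP] : forall x, exists i, (exists2 i, D i & F i x) ->
    D i /\ F i x.
  move=> x; case: (pselect (exists2 i, D i & F i x)) => [[i Di Fx]|nx].
    by exists i.
  by exists i0.
apply: small_le (small_setX sD sG).
apply: (@set_inj_card_le _ _ _ _ (fun x => (c x, g (c x) x))).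
  move=> x /cP[Dc Fc]; split=> //=; exists (f (c x)); first by exists (c x).
  by exists (c x), x.
move=> x x' /cP[Dc Fc] /cP[_ Fc'] [e]; rewrite -e in Fc' *.
exact: (gi _ Dc).
Qed.

Lemma small_setU (X : Type) (A B : set X) :
  small K A -> small K B -> small K (A `|` B).
Proof.
move=> sA sB.
have := @small_bigcup bool X [set: bool] (fun b : bool => if b then A else B).
move=> /(_ (small_finite finite_finset)) H.
apply: small_sub (H _); last by case.
by move=> x [Ax|Bx]; [exists true|exists false].
Qed.

Lemma small_sum (X Y : Type) :
  small K [set: X] -> small K [set: Y] -> small K [set: X + Y].
Proof.
move=> sX sY; apply: small_sub (small_setU (small_range inl sX) (small_range inr sY)).
by case=> z _; [left|right]; exists z.
Qed.

Lemma small_option (X : Type) : small K [set: X] -> small K [set: option X].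
Proof.
move=> sX; apply: small_sub (small_setU (small_range some sX)
  (small_finite (finite_set1 None))).
by case=> [x|] _; [left; exists x|right].
Qed.

Lemma small_seq (X : Type) : small K [set: X] -> small K [set: seq X].
Proof.
move=> sX.
have sn n : small K [set s : seq X | size s = n].
  elim: n => [|n IH].
    by apply: small_sub (small_finite (finite_set1 [::])) => -[].
  apply: small_sub (small_image (fun p => p.1 :: p.2) (small_setX sX IH)).
  by move=> [//|x s] /= [ss]; exists (x, s).
apply: small_sub (small_bigcup (small_countable (countableP [set: nat]))
  (fun n _ => sn n)).
by move=> s _; exists (size s).
Qed.

End Small.

(** * Well-founded trees *)

Inductive tree (A B C : Type) : Type :=
| Leaf of A
| Node of B & (C -> tree A B C).

(** The set of all paths from the root, each with the label found at its end. *)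
Fixpoint tree_code (A B C : Type) (t : tree A B C) : set (seq C * (A + B)) :=
  match t with
  | Leaf a => [set ([::], inl a)]
  | Node b f => [set p | match p.1 with
                         | [::] => p.2 = inr b
                         | c :: s => tree_code (f c) (s, p.2)
                         end]
  end.

Lemma tree_code_inj (A B C : Type) : injective (@tree_code A B C).
Proof.
elim=> [a|b f IH] [a'|b' f'] e.
- have : tree_code (Leaf B C a') ([::], inl a) by rewrite -e.
  by case=> ->.
- have : tree_code (Node b' f') ([::], inl a) by rewrite -e.
  by [].
- have : tree_code (Node b f) ([::], inl a') by rewrite e.
  by [].
- have : tree_code (Node b' f') ([::], inr b) by rewrite -e.
  move=> /= [eb]; congr Node; first exact: eb.
  apply/funext => c; apply: IH; apply/funext => -[s l].
  by have := congr1 (fun X => X (c :: s, l)) e.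
Qed.

Lemma small_tree (K A B C : Type) : strongly_inaccessible K ->
  small K [set: A] -> small K [set: B] -> small K [set: C] ->
  small K [set: tree A B C].
Proof.
move=> Kin sA sB sC.
have := small_powerset Kin (small_setX Kin (small_seq Kin sC) (small_sum Kin sA sB)).
apply: small_le; apply: (@set_inj_card_le _ _ _ _ (@tree_code A B C)) => //.
by move=> t t' _ _; exact: tree_code_inj.
Qed.

(** * Assignments, renaming and automorphisms *)

Lemma val_cons0 (X : Type) n (x : X) (v : 'I_n -> X) : val_cons x v ord0 = x.
Proof. by rewrite /val_cons unlift_none. Qed.

Lemma val_consS (X : Type) n (x : X) (v : 'I_n -> X) i :
  val_cons x v (lift ord0 i) = v i.
Proof. by rewrite /val_cons liftK. Qed.

Lemma val_cons_eta (X : Type) n (v : 'I_n.+1 -> X) :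
  val_cons (v ord0) (v \o lift ord0) = v.
Proof. by apply/funext => i; rewrite /val_cons; case: unliftP => [j|] ->. Qed.

Lemma comp_val_cons (X Y : Type) n (h : X -> Y) (x : X) (v : 'I_n -> X) :
  h \o val_cons x v = val_cons (h x) (h \o v).
Proof. by apply/funext => i; rewrite /= /val_cons; case: unlift. Qed.

Lemma val_cat_l (X : Type) m n (v : 'I_m -> X) (w : 'I_n -> X) i :
  val_cat v w (lshift n i) = v i.
Proof. by rewrite /val_cat (unsplitK (inl i)). Qed.

Lemma val_cat_r (X : Type) m n (v : 'I_m -> X) (w : 'I_n -> X) i :
  val_cat v w (rshift m i) = w i.
Proof. by rewrite /val_cat (unsplitK (inr i)). Qed.

Section Renaming.
Variable L : language.

Fixpoint rename_term m n (f : 'I_m -> 'I_n) (t : term L m) : term L n :=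
  match t with
  | Var i => Var L (f i)
  | App g ts => App (fun i => rename_term f (ts i))
  end.

Definition ren_lift m n (f : 'I_m -> 'I_n) : 'I_m.+1 -> 'I_n.+1 :=
  val_cons ord0 (lift ord0 \o f).

Fixpoint rename m (phi : formula L m) : forall n, ('I_m -> 'I_n) -> formula L n :=
  match phi in formula _ m return forall n, ('I_m -> 'I_n) -> formula L n with
  | Bot _ => fun n f => Bot
  | Equal _ t u => fun n f => Equal (rename_term f t) (rename_term f u)
  | Rel _ r ts => fun n f => Rel r (fun i => rename_term f (ts i))
  | Imp _ p q => fun n f => Imp (rename p f) (rename q f)
  | All _ p => fun n f => All (rename p (ren_lift f))
  end.

Lemma eval_rename (S : structure L) m n (f : 'I_m -> 'I_n) (v : 'I_n -> S) t :
  eval v (rename_term f t) = eval (v \o f) t.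
Proof. by elim: t => //= g ts IH; congr fun_of; apply/funext => i; exact: IH. Qed.

Lemma sat_rename (S : structure L) m (phi : formula L m) :
  forall n (f : 'I_m -> 'I_n) (v : 'I_n -> S),
  sat (rename phi f) v <-> sat phi (v \o f).
Proof.
elim: phi => {m} [m|m t u|m r ts|m p IHp q IHq|m p IH] n f v //=.
- by rewrite !eval_rename.
- have -> // : (fun i => eval v (rename_term f (ts i))) =
               (fun i => eval (v \o f) (ts i)).
  by apply/funext => i; exact: eval_rename.
- by rewrite IHp IHq.
- have e x : val_cons x v \o ren_lift f = val_cons x (v \o f).
    apply/funext => i; rewrite /ren_lift /= /val_cons.
    by case: (unlift ord0 i) => [j|]; rewrite ?liftK ?unlift_none.
  by split=> H x; move: (H x); rewrite IH e.
Qed.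

Lemma eval_automorphism (S : structure L) (s : S -> S) n (v : 'I_n -> S) t :
  automorphism s -> eval (s \o v) t = s (eval v t).
Proof.
move=> [_ sf _]; elim: t => //= g ts IH.
by rewrite sf; congr fun_of; apply/funext => i; exact: IH.
Qed.

Lemma sat_automorphism (S : structure L) (s : S -> S) n (phi : formula L n) :
  automorphism s -> forall v, sat phi (s \o v) <-> sat phi v.
Proof.
move=> sA; elim: phi => {n} [n|n t u|n r ts|n p IHp q IHq|n p IH] v //=.
- rewrite !(eval_automorphism _ _ sA); case: sA => [/bij_inj sinj _ _].
  by split=> [/sinj|->].
- have [_ _ srel] := sA; rewrite (srel r (fun i => eval v (ts i))).
  suff -> : (fun i => eval (s \o v) (ts i)) = s \o (fun i => eval v (ts i)) by [].
  by apply/funext => i; exact: eval_automorphism.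
- by rewrite IHp IHq.
- split=> H x.
    by rewrite -IH comp_val_cons.
  have [[s' _ s'K] _ _] := sA.
  by rewrite -(s'K x) -comp_val_cons IH.
Qed.

End Renaming.

(** * Definable relations over a set *)

Section Definable.
Variables (L : language) (U : structure L).

(** The value of a place that holds either a variable or a parameter. *)
Definition arg_val (V : Type) (x : V -> U) (a : V + U) : U :=
  match a with inl t => x t | inr u => u end.

(** Variables come from an arbitrary type and parameters are put directly in
    the places of a formula, so that substituting parameters for variables does
    not change the formula; [definable_iformula] recovers the separated form. *)
Definition definable (C : set U) (V : Type) (P : (V -> U) -> Prop) : Prop :=
  exists l (phi : formula L l) (g : 'I_l -> V + U),
    (forall i u, g i = inr u -> C u) /\
    forall x, P x <-> sat phi (arg_val x \o g).

Lemma definable_ext C V (P Q : (V -> U) -> Prop) :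
  (forall x, P x <-> Q x) -> definable C P -> definable C Q.
Proof.
by move=> PQ [l [phi [g [gC Pphi]]]]; exists l, phi, g; split=> // x; rewrite -PQ.
Qed.

Lemma definable_sub C D V (P : (V -> U) -> Prop) :
  C `<=` D -> definable C P -> definable D P.
Proof.
by move=> CD [l [phi [g [gC Pphi]]]]; exists l, phi, g; split=> // i u /gC /CD.
Qed.

Lemma definable_bot C V : definable C (fun _ : V -> U => False).
Proof.
have g : 'I_0 -> V + U by move=> i; case: (notF (valP i)).
by exists 0, Bot, g; split=> // -[].
Qed.

Lemma definable_eq C V (a b : V + U) :
  (forall u, a = inr u -> C u) -> (forall u, b = inr u -> C u) ->
  definable C (fun x => arg_val x a = arg_val x b).
Proof.
move=> aC bC; exists 2, (Equal (Var L ord0) (Var L ord_max)).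
by exists (fun i => if i == ord0 then a else b); split=> // i u; case: ifP => _; auto.
Qed.

Lemma definable_imp C V (P Q : (V -> U) -> Prop) :
  definable C P -> definable C Q -> definable C (fun x => P x -> Q x).
Proof.
move=> [l [phi [g [gC Pphi]]]] [k [psi [h [hC Qpsi]]]].
exists (l + k), (Imp (rename phi (lshift k)) (rename psi (@rshift l k))), (val_cat g h).
split=> [i u|x].
  by rewrite /val_cat; case: fintype.split => j; [exact: gC|exact: hC].
rewrite /= !sat_rename Pphi Qpsi.
have -> : (arg_val x \o val_cat g h) \o lshift k = arg_val x \o g.
  by apply/funext => i; rewrite /= val_cat_l.
have -> // : (arg_val x \o val_cat g h) \o @rshift l k = arg_val x \o h.
by apply/funext => i; rewrite /= val_cat_r.
Qed.

Lemma definable_not C V (P : (V -> U) -> Prop) :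
  definable C P -> definable C (fun x => ~ P x).
Proof. by move/definable_imp; apply; exact: definable_bot. Qed.

Lemma definable_and C V (P Q : (V -> U) -> Prop) :
  definable C P -> definable C Q -> definable C (fun x => P x /\ Q x).
Proof.
move=> dP dQ.
apply: definable_ext (definable_not (definable_imp dP (definable_not dQ))) => x.
split=> [nPQ|[Px Qx]]; last by apply.
by split; apply: contrapT => n; apply: nPQ.
Qed.

Definition update V (x : V -> U) (t : V) (a : U) : V -> U :=
  fun s => if pselect (s = t) then a else x s.

Lemma definable_ex_at C V (P : (V -> U) -> Prop) (t : V) :
  definable C P -> definable C (fun x => exists a, P (update x t a)).
Proof.
move=> /definable_not[l [phi [g [gC nPphi]]]].
suff : definable C (fun x => forall a, ~ P (update x t a)).
  move/definable_not; apply: definable_ext => x.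
  by rewrite -existsNP; split=> -[a]; [move/contrapT|]; exists a.
pose f i : 'I_l.+1 := if pselect (g i = inl t) then ord0 else lift ord0 i.
exists l, (All (rename phi f)), g; split=> // x.
have e a : val_cons a (arg_val x \o g) \o f = arg_val (update x t a) \o g.
  apply/funext => i; rewrite /= /f; case: pselect => gi.
    by rewrite val_cons0 gi /= /update; case: pselect.
  rewrite val_consS /=; case E : (g i) gi => [s|u] //= gi.
  by rewrite /update; case: pselect => // st; case: gi; rewrite st.
split=> /= H a.
  by apply/sat_rename; rewrite e -nPphi.
by rewrite nPphi -e; apply/sat_rename; exact: H.
Qed.

(** Only finitely many variables occur in a formula, so any set of variables,
    however large, can be quantified at once. *)
Lemma definable_ex C V (S : set V) (P : (V -> U) -> Prop) :
  definable C P ->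
  definable C (fun x => exists x', (forall t, ~ S t -> x' t = x t) /\ P x').
Proof.
move=> dP.
have exs (s : seq {classic V}) : definable C (fun x => exists x',
    (forall t : {classic V}, t \notin s -> x' t = x t) /\ P x').
  elim: s => [|t s IH].
    apply: definable_ext dP => x; split=> [Px|[x' [xx' Px']]]; first by exists x.
    suff -> : x = x' by [].
    by apply/funext => t; rewrite xx'.
  apply: definable_ext (definable_ex_at (t : V) IH) => x.
  split=> [[a [x' [x'x Px']]]|[x' [x'x Px']]].
    exists x'; split=> // r; rewrite in_cons negb_or => /andP[rt nr].
    by rewrite x'x // /update; case: pselect => //= e; rewrite e eqxx in rt.
  exists (x' t), x'; split=> // r nr; rewrite /update.
  case: pselect => /= [rt|rt]; first by rewrite rt.
  by apply: x'x; rewrite in_cons negb_or nr andbT; apply/eqP.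
have [l [phi [g [_ Pphi]]]] := dP.
pose s : seq {classic V} := pmap (fun i => if g i is inl t then
  if pselect (S t) then Some t else None else None) (enum 'I_l).
have sP (t : {classic V}) : t \in s <-> S t /\ exists i, g i = inl t.
  rewrite mem_pmap; split=> [/mapP[i _]|[St [i git]]].
    case E: (g i) => [r|//]; case: pselect => //= Sr [->].
    by split=> //; exists i.
  by apply/mapP; exists i; rewrite ?mem_enum// git; case: pselect.
apply: definable_ext (exs s) => x.
split=> -[x' [x'x Px']].
  exists x'; split=> // t nS; apply: x'x; apply/negP => ts.
  by have [/nS] := (sP t).1 ts.
exists (fun t => if pselect (S t /\ exists i, g i = inl t) then x' t else x t).
split=> [t nt|].
  by case: pselect => //= /sP ts; rewrite ts in nt.
move: Px'; rewrite !Pphi; suff -> : arg_val x' \o g = arg_val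
  (fun t => if pselect (S t /\ exists i, g i = inl t) then x' t else x t) \o g by [].
apply/funext => i /=; case E : (g i) => [t|u] //=; case: pselect => // nSt.
by apply: x'x => St; apply: nSt; split=> //; exists i.
Qed.

Lemma definable_subst C V W (h : V -> W + U) (P : (V -> U) -> Prop) :
  (forall t u, h t = inr u -> C u) -> definable C P ->
  definable C (fun x => P (arg_val x \o h)).
Proof.
move=> hC [l [phi [g [gC Pphi]]]].
exists l, phi, (fun i => match g i with inl t => h t | inr u => inr u end).
split=> [i u|x].
  by case E: (g i) => [t|u']; [exact: hC | move=> [<-]; exact: gC E].
rewrite Pphi.
have -> : arg_val (arg_val x \o h) \o g =
   arg_val x \o (fun i => match g i with inl t => h t | inr u => inr u end); last by [].
by apply/funext => i /=; case: (g i).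
Qed.

Lemma definable_isat C V (q : iformula U V) : Defs.over C q -> definable C (isat q).
Proof.
case: q => -[n k m vs] b /= Cb.
exists (n + k), m, (val_cat (inl \o vs) (inr \o b)); split=> [i u|x].
  by rewrite /val_cat; case: fintype.split => j //= [<-].
suff -> : arg_val x \o val_cat (inl \o vs) (inr \o b) = val_cat (x \o vs) b by [].
by apply/funext => i /=; rewrite /val_cat; case: fintype.split.
Qed.

(** The case where [g] is nowhere defined is separate because there is then no
    default element to complete it with; [X] may even be empty. *)
Lemma partial_codom (X : Type) l (g : 'I_l -> option X) :
  exists n (h : 'I_n -> X), (forall i x, g i = Some x -> exists j, h j = x) /\
    forall j, exists i, g i = Some (h j).
Proof.
case: (pselect (exists i x, g i = Some x)) => [[i0 [x0 gi0]]|ng].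
  exists l, (fun i => odflt x0 (g i)); split=> [i x gi|i]; first by exists i; rewrite gi.
  by case E: (g i) => [x|]; [exists i|exists i0].
have h : 'I_0 -> X by move=> i; case: (notF (valP i)).
by exists 0, h; split=> [i x gi|[]//]; case: ng; exists i, x.
Qed.

Lemma definable_iformula C V (P : (V -> U) -> Prop) :
  definable C P -> exists2 q : iformula U V, Defs.over C q & forall x, isat q x <-> P x.
Proof.
move=> [l [phi [g [gC Pphi]]]].
have [n [vs [vsP _]]] := partial_codom (fun i => if g i is inl t then Some t else None).
have [k [b [bP bg]]] := partial_codom (fun i => if g i is inr u then Some u else None).
have /choice[f fP] : forall i, exists j : 'I_(n + k), forall x,
    val_cat (x \o vs) b j = arg_val x (g i).
  move=> i; case E: (g i) => [t|u].
    have [|j <-] := vsP i t; first by rewrite E.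
    by exists (lshift k j) => x; rewrite val_cat_l.
  have [|j <-] := bP i u; first by rewrite E.
  by exists (rshift n j) => x; rewrite val_cat_r.
exists (@IFormula L U V (@PFormula L V n k (rename phi f) vs) b) => [j /=|x].
  by have [i] := bg j; case E: (g i) => [//|u] [<-]; exact: gC E.
rewrite Pphi /isat /psat /=.
have -> : arg_val x \o g = val_cat (x \o vs) b \o f; last exact: sat_rename.
by apply/funext => i; rewrite /= fP.
Qed.

Lemma definable_automorphism C V (P : (V -> U) -> Prop) s :
  automorphism_over C s -> definable C P -> forall x, P (s \o x) <-> P x.
Proof.
move=> [sA sC] [l [phi [g [gC Pphi]]]] x; rewrite !Pphi.
rewrite -(sat_automorphism phi sA (arg_val x \o g)).
suff -> : arg_val (s \o x) \o g = s \o (arg_val x \o g) by [].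
by apply/funext => i /=; case E: (g i) => [//|u] /=; rewrite sC //; exact: gC E.
Qed.

End Definable.

(** * Small elementary substructures *)

Section TarskiVaught.
Variables (L : language) (U : structure L).

Definition tarski_vaught (N : set U) : Prop :=
  forall n (phi : formula L n.+1) (v : 'I_n -> U), (forall i, N (v i)) ->
    (exists x, sat phi (val_cons x v)) -> exists2 x, N x & sat phi (val_cons x v).

Lemma tarski_vaught_elementary (N : set U) :
  tarski_vaught N -> elementary_substructure N.
Proof.
move=> tvN.
have N0 : N !=set0.
  have [u] := carrier_inhabited U.
  have v : 'I_0 -> U by move=> i; case: (notF (valP i)).
  have [||x Nx _] := tvN 0 (Imp Bot Bot) v; last by exists x.
    by move=> i; case: (notF (valP i)).
  by exists u.
have Nf : fun_closed N.
  move=> f v Nv.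
  have [|x Nx /=] := tvN _ (Equal (Var L ord0) (App (fun i => Var L (lift ord0 i)))) v Nv.
    exists (fun_of U f v) => /=; rewrite val_cons0; congr fun_of.
    by apply/funext => i; rewrite val_consS.
  rewrite val_cons0 => e; rewrite e in Nx.
  suff <- : (fun i => val_cons x v (lift ord0 i)) = v by [].
  by apply/funext => i; rewrite val_consS.
exists N0, Nf.
have evalE n (v : 'I_n -> substructure N0 Nf) t : eval (val \o v) t = val (eval v t).
  by elim: t => //= f ts IH; congr fun_of; apply/funext => i; exact: IH.
move=> n phi; elim: phi => {n} [n|n t u|n r ts|n p IHp q IHq|n p IH] v //=.
- by rewrite !evalE; split=> [->//|/val_inj].
- suff -> : (fun i => eval (val \o v) (ts i)) = val \o (fun i => eval v (ts i)) by [].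
  by apply/funext => i; exact: evalE.
- by rewrite IHp IHq.
- split=> H x; last by rewrite IH comp_val_cons; exact: H.
  apply: contrapT => nx.
  have [||y Ny /=] := tvN _ (Imp p Bot) (val \o v).
  + by move=> i; apply/set_mem/(valP (v i)).
  + by exists x.
  + apply.
    by have := H (exist _ y (mem_set Ny)); rewrite IH comp_val_cons.
Qed.

End TarskiVaught.

Section LowenheimSkolem.
Variables (L : language) (U : structure L).

(** Formulas are counted through their semantics: a tree of symbols denotes a
    relation on assignments of all natural numbers, and every formula is denoted
    by some tree. This avoids encoding the dependent family of formulas. *)
Inductive connective := CEqual | CImp | CAll.

Definition scons (x : U) (v : nat -> U) : nat -> U :=
  fun i => if i is j.+1 then v j else x.

Definition code : Type := tree nat (Defs.fsym L + (rsym L + connective))%type nat.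

Fixpoint term_den (c : code) (v : nat -> U) : U :=
  match c with
  | Leaf i => v i
  | Node (inl f) cs => fun_of U f (fun i => term_den (cs i) v)
  | Node (inr _) _ => v 0
  end.

Fixpoint formula_den (c : code) (v : nat -> U) : Prop :=
  match c with
  | Leaf _ => False
  | Node (inl _) _ => False
  | Node (inr (inl r)) cs => rel_of U r (fun i => term_den (cs i) v)
  | Node (inr (inr CEqual)) cs => term_den (cs 0) v = term_den (cs 1) v
  | Node (inr (inr CImp)) cs => formula_den (cs 0) v -> formula_den (cs 1) v
  | Node (inr (inr CAll)) cs => forall x, formula_den (cs 0) (scons x v)
  end.

Lemma term_code_exists n (t : term L n) : exists c : code,
  forall (v : 'I_n -> U) (w : nat -> U), (forall i : 'I_n, w i = v i) ->
    term_den c w = eval v t.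
Proof.
elim: t => [i|f ts /choice[cs csP]].
  by exists (Leaf _ _ (nat_of_ord i)) => v w wv /=.
exists (Node (inl f) (fun k => if insub k is Some i then cs i else Leaf _ _ 0)).
move=> v w wv /=; congr fun_of; apply/funext => i.
by rewrite valK; exact: csP.
Qed.

Lemma formula_code_exists n (phi : formula L n) : exists c : code,
  forall (v : 'I_n -> U) (w : nat -> U), (forall i : 'I_n, w i = v i) ->
    (formula_den c w <-> sat phi v).
Proof.
elim: phi => {n} [n|n t u|n r ts|n p [c cP] q [d dP]|n p [c cP]].
- by exists (Leaf _ _ 0).
- have [c cP] := term_code_exists t; have [d dP] := term_code_exists u.
  exists (Node (inr (inr CEqual)) (fun k => if k is 0 then c else d)) => v w wv /=.
  by rewrite (cP v) ?(dP v).
- have /choice[cs csP] := fun i => term_code_exists (ts i).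
  exists (Node (inr (inl r)) (fun k => if insub k is Some i then cs i else Leaf _ _ 0)).
  move=> v w wv /=.
  suff -> : (fun i : 'I_(rarity r) => term_den (match insub (i : nat) with
      | Some j => cs j | None => Leaf _ _ 0 end) w) = (fun i => eval v (ts i)) by [].
  by apply/funext => i; rewrite valK; exact: csP.
- exists (Node (inr (inr CImp)) (fun k => if k is 0 then c else d)) => v w wv /=.
  by rewrite (cP v) ?(dP v).
- exists (Node (inr (inr CAll)) (fun=> c)) => v w wv /=.
  have e x i : scons x w (i : 'I_n.+1) = val_cons x v i.
    rewrite /val_cons; case: unliftP => [j|] -> //=.
    by rewrite -wv.
  by split=> H x; move: (H x); rewrite (cP (val_cons x v)).
Qed.

Lemma small_code (K : Type) : strongly_inaccessible K -> countable_language L ->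
  small K [set: code].
Proof.
move=> Kin [fc rc]; apply: small_tree => //.
- exact: small_countable.
- apply: (small_sum Kin); first exact: small_countable.
  apply: (small_sum Kin); first exact: small_countable.
  have := small_range (fun o : option bool => match o with
    | None => CAll | Some true => CImp | Some false => CEqual end)
    (small_finite Kin (@finite_finset _ [set: option bool])).
  apply: small_sub => -[] _; [by exists (Some false)|by exists (Some true)|by exists None].
- exact: small_countable.
Qed.

(** The elements of a Skolem hull are values of trees whose nodes are labelled
    by codes of formulas and act as Skolem functions. Nodes have countably many
    children, whatever the arity; this costs nothing since K is inaccessible. *)
Lemma downward_lowenheim_skolem (K : Type) (X : set U) :
  strongly_inaccessible K -> countable_language L -> small K X ->
  exists N : set U, [/\ small K N, tarski_vaught N & X `<=` N].
Proof.
move=> Kin Lc sX; have [pt] := carrier_inhabited U.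
have /choice[sk skP] : forall cw : code * (nat -> U), exists x,
    (exists y, formula_den cw.1 (scons y cw.2)) -> formula_den cw.1 (scons x cw.2).
  move=> [c w] /=; case: (pselect (exists y, formula_den c (scons y w))) => [[y Py]|nP].
    by exists y.
  by exists pt.
pose fix hull (t : tree (option X) code nat) : U :=
  match t with
  | Leaf a => if a is Some x then val x else pt
  | Node c ts => sk (c, fun i => hull (ts i))
  end.
exists (range hull); split.
- apply: small_range; apply: small_tree => //.
  + exact/(small_option Kin)/small_setT.
  + exact: small_code.
  + exact: small_countable.
- move=> n phi v hv [x phix].
  have /choice[ts tsP] : forall i, exists t, hull t = v i.
    by move=> i; have [t _ ht] := hv i; exists t.
  have [c cP] := formula_code_exists phi.
  pose ts' k := if insub k is Some i then ts i else Leaf _ _ None.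
  have e y : formula_den c (scons y (fun k => hull (ts' k))) <-> sat phi (val_cons y v).
    apply: cP => i; rewrite /val_cons; case: unliftP => [j|] -> //=.
    by rewrite /ts' valK tsP.
  exists (hull (Node c ts')); first by exists (Node c ts').
  by apply/e; apply: (skP (c, _)); exists x; apply/e.
- move=> x Xx; exists (Leaf _ _ (Some (exist _ x (mem_set Xx)))) => //.
Qed.

End LowenheimSkolem.

(** * Conjugation *)

Section Automorphisms.
Variables (L : language) (U : structure L).

Lemma automorphism_inverse (s : U -> U) : automorphism s ->
  exists s', [/\ automorphism s', cancel s s' & cancel s' s].
Proof.
move=> [[s' sK s'K] sf sr]; exists s'; split=> //; split.
- by exists s.
- move=> f v; apply: (can_inj sK); rewrite s'K sf; congr fun_of.
  by apply/funext => i /=; rewrite s'K.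
- move=> r v; rewrite [X in _ <-> X]sr.
  suff -> : s \o (s' \o v) = v by [].
  by apply/funext => i /=; rewrite s'K.
Qed.

Lemma automorphism_over_image (C X : set U) s :
  automorphism_over C s -> X `<=` C -> s @` X = X.
Proof.
move=> [_ sC] XC; apply/seteqP; split=> [_ [x Xx <-]|x Xx].
  by rewrite sC //; exact: XC.
by exists x => //; apply: sC; exact: XC.
Qed.

Lemma tp_automorphism (C : set U) (I : Type) (a : I -> U) s :
  automorphism_over C s -> tp (s \o a) C = tp a C.
Proof.
move=> sC; apply/seteqP; split=> q [Cq aq]; split=> //.
  exact: (definable_automorphism sC (definable_isat Cq) a).1 aq.
exact: (definable_automorphism sC (definable_isat Cq) a).2 aq.
Qed.

(** Strong homogeneity is about maps, so the type of a finite tuple is turned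
    into a partial elementary map which is the identity on M. *)
Lemma conjugate (K : Type) (M : set U) n (e e' : 'I_n -> U) :
  strongly_inaccessible K -> strongly_homogeneous K U -> small K M ->
  (forall P, definable M P -> P e -> P e') ->
  exists2 s, automorphism_over M s & s \o e = e'.
Proof.
move=> Kin hom sM ee'.
have ee'E P : definable M P -> P e <-> P e'.
  move=> dP; split; first exact: ee'.
  by move=> Pe'; apply: contrapT => /(ee' _ (definable_not dP)).
have /choice[h hP] : forall u, exists u', (M u -> u' = u) /\
    (~ M u -> (exists i, e i = u) -> exists i, e i = u /\ u' = e' i).
  move=> u; case: (pselect (M u)) => Mu; first by exists u.
  case: (pselect (exists i, e i = u)) => [[i ei]|ne]; last by exists u.
  by exists (e' i); split=> // _ _; exists i.
have hM u : M u -> h u = u by case: (hP u).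
(* Writing a tuple of M and the e_i in terms of places reduces the elementarity
   of h to the hypothesis on e and e'. *)
have he l (v : 'I_l -> U) : (forall j, (M `|` range e) (v j)) ->
    exists g : 'I_l -> 'I_n + U, [/\ forall j u, g j = inr u -> M u,
      v = arg_val e \o g & h \o v = arg_val e' \o g].
  move=> Mv.
  have /choice[g gP] : forall j, exists a : 'I_n + U,
      [/\ forall u, a = inr u -> M u, v j = arg_val e a & h (v j) = arg_val e' a].
    move=> j; case: (pselect (M (v j))) => Mvj.
      by exists (inr (v j)); split=> [u [<-]| |] //=; exact: hM.
    have [_ /(_ Mvj)[|i [ei ->]]] := hP (v j).
      by case: (Mv j) => // -[i _ ei]; exists i.
    by exists (inl i).
  exists g; split=> [j u gj| |]; first by case: (gP j) => + _ _; exact.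
    by apply/funext => j; case: (gP j).
  by apply/funext => j; case: (gP j).
have [||s [sA sh]] := hom (M `|` range e) h.
- apply: small_setU => //; apply: small_range; exact/small_finite/finite_finset.
- move=> l phi v /he[g [gM -> ->]].
  apply: (ee'E (fun x => sat phi (arg_val x \o g))).
  by exists l, phi, g.
have sM' : automorphism_over M s by split=> // m Mm; rewrite sh ?hM //; left.
exists s => //; apply/funext => i /=.
have [g [gM eg hg]] := he 1 (fun=> e i) (fun _ => or_intror (imageP e I)).
have := congr1 (fun f => f ord0) hg; rewrite /= sh; last by right; exists i.
move=> ->; apply/esym.
apply: (ee' (fun x => arg_val x (inl i) = arg_val x (g ord0))).
  by apply: definable_eq => // u; exact: gM.
exact: (congr1 (fun f => f ord0) eg).
Qed.

End Automorphisms.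

(** * Limits of sequences of tuples along an ultrafilter *)

Section Limits.
Variables (L : language) (U : structure L).

Definition sum_val (V W : Type) (x : V -> U) (y : W -> U) (t : V + W) : U :=
  match t with inl v => x v | inr w => y w end.

(** The parameter [u] fills the places of the quantified variables, which no
    longer matter after quantification but still occur in the formula. *)
Lemma definable_exists (C : set U) u V W (P : (V + W -> U) -> Prop) : C u ->
  definable C P -> definable C (fun x => exists y : W -> U, P (sum_val x y)).
Proof.
move=> Cu /(definable_ex [set t | if t is inr _ then True else False]).
pose h (t : V + W) : V + U := match t with inl v => inl v | inr w => inr u end.
move/(definable_subst (h := h)) => H.
apply: definable_ext (H _) => [x|[v|w] u' //= [<-] //].
split=> [[x' [x'x Px']]|[y Pxy]].
  exists (x' \o inr); suff -> : sum_val x (x' \o inr) = x' by [].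
  by apply/funext => -[v|w] //=; rewrite x'x //=; apply.
by exists (sum_val x y); split=> // -[v|w] //= /(_ I).
Qed.

Lemma definable_forall_lt (C : set U) k V (P : nat -> (V -> U) -> Prop) :
  (forall j, j < k -> definable C (P j)) ->
  definable C (fun x => forall j, j < k -> P j x).
Proof.
elim: k => [|k IH] dP.
  by apply: definable_ext (definable_not (@definable_bot L U C V)) => x; split=> // _.
have dlt : definable C (fun x => forall j, j < k -> P j x).
  by apply: IH => j jk; apply: dP; exact: ltnW.
apply: definable_ext (definable_and dlt (dP k (ltnSn k))) => x.
split=> [[Plt Pk] j|Pj]; last by split=> [j jk|]; apply: Pj => //; exact: ltnW.
by rewrite ltnS leq_eqVlt => /orP[/eqP ->|/Plt].
Qed.

(** Only one direction is required: complements of definable relations are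
    definable, so the converse holds for an ultrafilter ([limitP]). *)
Definition limit (F : set_system nat) (C : set U) (V : Type)
    (b : nat -> V -> U) (e : V -> U) : Prop :=
  forall P, definable C P -> F [set i | P (b i)] -> P e.

Lemma limit_sub F C D V (b : nat -> V -> U) e :
  C `<=` D -> limit F D b e -> limit F C b e.
Proof. by move=> CD De P dP; apply: De; exact: definable_sub dP. Qed.

Lemma limitP F C V (b : nat -> V -> U) e P : UltraFilter F ->
  limit F C b e -> definable C P -> P e <-> F [set i | P (b i)].
Proof.
move=> FU Le dP; split=> [Pe|]; last exact: Le.
have [//|nP] := in_ultra_setVsetC [set i | P (b i)] FU.
by have := Le _ (definable_not dP) nP.
Qed.

(** Saturation concerns one variable, so coordinates are realised one after
    another: once [e] is a limit of the tails, the conditions on a further first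
    coordinate are finitely satisfiable because an existential statement that
    holds of almost all tails holds of [e]. *)
Lemma limit_exists K F (C : set U) n (b : nat -> 'I_n -> U) :
  strongly_inaccessible K -> saturated K U -> UltraFilter F -> small K C ->
  exists e, limit F C b e.
Proof.
move=> Kin sat FU sC; have [pt] := carrier_inhabited U.
wlog Cpt : C sC / C pt.
  have sC' : small K (C `|` [set pt]).
    exact/(small_setU Kin)/small_finite/finite_set1.
  move=> /(_ _ sC')[|e Le]; first by right.
  by exists e; apply: limit_sub Le => x; left.
elim: n b => [|n IH] b.
  exists (b 0) => P _ /filter_ex[i /=]; suff -> : b i = b 0 by [].
  by apply/funext => -[].
have [e Le] := IH (fun i => b i \o lift ord0).
have sC' : small K (C `|` range e).
  exact/(small_setU Kin)/small_range/small_finite/finite_finset.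
pose p := [set q : iformula U unit | Defs.over (C `|` range e) q /\
  exists P : ('I_n.+1 -> U) -> Prop, [/\ definable C P, F [set i | P (b i)] &
    forall y, isat q (fun=> y) <-> P (val_cons y e)]].
have fin (s : seq {classic (iformula U unit)}) : (forall q, q \in s -> p q) ->
    exists P : ('I_n.+1 -> U) -> Prop, [/\ definable C P, F [set i | P (b i)] &
    forall y, P (val_cons y e) -> forall q, q \in s -> isat q (fun=> y)].
  elim: s => [|q s IHs] ps.
    exists (fun=> ~ False); split=> //; first exact/definable_not/definable_bot.
    by apply: filterS filterT => i _.
  have [|P [dP FP Ps]] := IHs; first by move=> r rs; apply: ps; rewrite in_cons rs orbT.
  have [|_ [Q [dQ FQ Qq]]] := ps q; first by rewrite in_cons eqxx.
  exists (fun x => P x /\ Q x); split; first exact: definable_and.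
    exact: filterI FP FQ.
  move=> y [Py Qy] r; rewrite in_cons => /orP[/eqP ->|]; last exact: Ps.
  exact/Qq.
have [||x px] := sat _ p sC'; first by move=> q [].
  move=> p0 p0p /(@finite_seqP {classic (iformula U unit)})[s p0s].
  have [|P [dP FP Ps]] := fin s.
    by move=> q qs; apply: p0p; rewrite p0s.
  suff [y Py] : exists y, P (val_cons y e).
    by exists (fun=> y) => q; rewrite p0s => /(Ps y Py).
  pose h : 'I_n.+1 -> ('I_n + unit) + U := val_cons (inl (inr tt)) (inl \o inl).
  have dP' : definable C (fun x => P (arg_val x \o h)).
    by apply: definable_subst dP => t u; rewrite /h /val_cons; case: unlift.
  have hE (x : 'I_n -> U) (y : unit -> U) : arg_val (sum_val x y) \o h = val_cons (y tt) x.
    by rewrite /h comp_val_cons.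
  suff [y] : exists y : unit -> U, P (arg_val (sum_val e y) \o h).
    by rewrite hE; exists (y tt).
  apply: (Le _ (definable_exists Cpt dP')).
  apply: filterS FP => i /= Pbi; exists (fun=> b i ord0).
  by rewrite hE val_cons_eta.
have ex : x = (fun=> x tt) by apply/funext => -[].
exists (val_cons (x tt) e) => P dP FP.
pose h : 'I_n.+1 -> unit + U := val_cons (inl tt) (inr \o e).
have dP' : definable (C `|` range e) (fun x => P (arg_val x \o h)).
  apply: definable_subst; last by apply: definable_sub dP => y; left.
  by move=> t u; rewrite /h /val_cons; case: unlift => [i|] //= [<-]; right; exists i.
have [q Cq qP] := definable_iformula dP'.
have qE y : isat q (fun=> y) <-> P (val_cons y e) by rewrite qP /h comp_val_cons.
by apply/qE; rewrite -ex; apply: px; split=> //; exists P.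
Qed.

(** In a consistent family of instances at e_0, ..., e_(k-1), the last term can
    be replaced by almost every b_i, since consistency of the family is a
    definable property of that term over the preceding ones and the b_i. Doing
    so down to e_0, with a new index each time, contradicts k-inconsistency. *)
Lemma limit_inconsistent F I (p : pformula L I) (k : nat)
    (b e : nat -> 'I_(npar p) -> U) (M : nat -> set U) :
  UltraFilter F -> (forall N, F [set i | N <= i]) ->
  (forall j i, range (b i) `<=` M j) ->
  (forall i j, i < j -> range (e i) `<=` M j) ->
  (forall j, M j !=set0) ->
  (forall j, limit F (M j) b (e j)) ->
  k_inconsistent k b -> ~ exists x : I -> U, forall j, j < k -> psat x (e j).
Proof.
move=> FU FN bM eM M0 Le incb [x0 x0P].
(* In Q m the terms from m on have been replaced, e_j by b_(sg j). *)
pose Q m := exists sg : nat -> nat,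
    (forall j j', m <= j < k -> m <= j' < k -> sg j = sg j' -> j = j') /\
    exists x : I -> U, forall j, j < k -> psat x (if j < m then e j else b (sg j)).
have step m : m < k -> Q m.+1 -> Q m.
  move=> mk [sg [sginj xP]].
  pose P (y : 'I_(npar p) -> U) := exists x : I -> U, forall j, j < k ->
    psat x (if j == m then y else if j < m then e j else b (sg j)).
  have dP : definable (M m) P.
    have [u Mu] := M0 m.
    pose Pj j (z : 'I_(npar p) + I -> U) := psat (z \o inr)
      (if j == m then z \o inl else if j < m then e j else b (sg j)).
    have dPj j : j < k -> definable (M m) (Pj j).
      move=> jk; rewrite /Pj; case: eqVneq => [_|jm].
        exists (nvar p + npar p), (matrix p).
        exists (val_cat (inl \o (inr \o @vars _ _ p)) (inl \o inl)); split=> [i v|z].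
          by rewrite /val_cat; case: fintype.split.
        suff -> : arg_val z \o val_cat (inl \o (inr \o @vars _ _ p)) (inl \o inl) =
            val_cat ((z \o inr) \o @vars _ _ p) (z \o inl) by [].
        by apply/funext => i; rewrite /= /val_cat; case: fintype.split.
      pose d := if j < m then e j else b (sg j).
      have Md : Defs.over (M m) (@IFormula L U I p d).
        move=> i; rewrite /= /d; case: ifP => [jm'|_]; last by apply: bM; exists i.
        by apply: (eM _ _ jm'); exists i.
      have := @definable_subst _ _ _ _ ('I_(npar p) + I)%type (inl \o inr) _ _ (definable_isat Md).
      by apply.
    apply: definable_ext (definable_exists Mu (definable_forall_lt dPj)) => y.
    by split=> -[x xj]; exists x => j /xj.
  have Pe : P (e m).
    have [x xj] := xP; exists x => j /xj; rewrite ltnS leq_eqVlt.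
    by case: eqVneq => [->|].
  have FP := (limitP FU (Le m) dP).1 Pe.
  have [i [/= [x xj] ni]] := filter_ex (filterI FP (FN (\max_(j < k) sg j).+1)).
  exists (fun j => if j == m then i else sg j); split; last first.
    exists x => j /xj; case: eqVneq => [->|//]; by rewrite ltnn.
  have sgi j : j < k -> sg j <> i.
    move=> jk e'; have := leq_bigmax (F := fun j : 'I_k => sg j) (Ordinal jk).
    by rewrite /= e' leqNgt ni.
  move=> j j' /andP[mj jk] /andP[mj' jk'].
  case: eqVneq => [->|jm]; case: eqVneq => [->//|j'm].
  - by move=> /esym /(sgi _ jk').
  - by move=> /(sgi _ jk).
  - by apply: sginj; rewrite ltn_neqAle eq_sym ?jm ?j'm ?mj ?mj' ?jk ?jk'.
have Qk : Q k.
  exists id; split=> //; exists x0 => j jk; rewrite jk; exact: x0P.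
have Qsub l : l <= k -> Q (k - l).
  elim: l => [|l IH] lk; first by rewrite subn0.
  by apply: step; [rewrite ltn_subrL (leq_ltn_trans _ lk)|rewrite subnSK //; exact/IH/ltnW].
have [sg [sginj [x xP]]] := Qsub k (leqnn k).
rewrite subnn in sginj xP.
apply: (incb (sg \o @nat_of_ord k)).
  by move=> j j' e'; apply/val_inj/sginj; rewrite /= ?ltn_ord.
by exists x => j; exact: xP.
Qed.

End Limits.
(** * Independent sequences of realisations of a limit type *)

Section Chain.
Variables (L : language) (K : Type) (U : structure L).
Hypotheses (Kin : strongly_inaccessible K) (Lc : countable_language L).
Hypotheses (Usat : saturated K U) (Uhom : strongly_homogeneous K U).

Lemma limit_conjugate F (C : set U) n (b : nat -> 'I_n -> U) e e' :
  UltraFilter F -> small K C -> limit F C b e -> limit F C b e' ->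
  exists2 s, automorphism_over C s & s \o e = e'.
Proof.
move=> FU sC Le Le'; apply: (conjugate Kin Uhom sC) => P dP Pe.
by apply/(limitP FU Le' dP)/(limitP FU Le dP).
Qed.

Lemma small_tuple n (e : 'I_n -> U) : small K (range e).
Proof. exact/small_range/(small_finite Kin)/finite_finset. Qed.

Lemma automorphism_invariant (R : indep_relation U) A C B s :
  invariant_relation K R -> small K A -> small K C -> small K B ->
  automorphism s -> R A C B -> R (s @` A) (s @` C) (s @` B).
Proof. by move=> Rinv sA sC sB sAut; rewrite -(Rinv A C B). Qed.

(** The single tuple whose local character is used realises the limit type over
    the union B of a family of models indexed by trees with small branching.
    Its base, of size at most that of [kappa], lies in one of the models, and
    its independence over that model is passed by conjugation to the terms of a
    sequence chosen inside B. *)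
Lemma independent_chain (R0 : indep_relation U) F n (b : nat -> 'I_n -> U)
    (X0 : set U) :
  invariant_relation K R0 -> right_monotonicity K R0 ->
  right_base_monotonicity K R0 -> local_character K R0 ->
  UltraFilter F -> small K X0 ->
  exists (M : nat -> set U) (e : nat -> 'I_n -> U),
    [/\ forall j, small K (M j), tarski_vaught (M 0), X0 `<=` M 0,
        forall i j, i <= j -> M i `<=` M j &
        [/\ forall i j, i < j -> range (e i) `<=` M j,
            forall j, limit F (M j) b (e j) &
            forall j, R0 (range (e j)) (M 0) (\bigcup_(i in `I_j) range (e i))]].
Proof.
move=> R0inv R0mon R0base R0loc FU sX0.
(* Total functions choosing a model above, and a limit over, each small set. *)
have /choice[hl hlP] : forall X : set U, exists N : set U,
    small K X -> [/\ small K N, tarski_vaught N & X `<=` N].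
  move=> X; case: (pselect (small K X)) => sX; last by exists set0.
  by have [N NP] := downward_lowenheim_skolem Kin Lc sX; exists N.
have /choice[re reP] : forall X : set U, exists e, small K X -> limit F X b e.
  move=> X; case: (pselect (small K X)) => sX; last by exists (b 0).
  by have [e Le] := limit_exists b Kin Usat FU sX; exists e.
have s0 : small K (@set0 U) by exact/(small_finite Kin)/finite_set0.
(* The branching of the trees depends on the cardinal given by local character,
   so the latter is taken for a limit over the empty set, known in advance. *)
pose d0 := re set0.
have [kappa [skappa loc]] := R0loc _ (small_tuple d0).
pose tr := tree unit unit (option kappa).
pose fix mod (t : tr) : set U := match t with
  | Leaf _ => hl X0
  | Node _ f => hl (X0 `|` \bigcup_(c in [set: option kappa])
                              (mod (f c) `|` range (re (mod (f c)))))
  end.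
pose sup (f : option kappa -> tr) : tr := Node tt f.
have sC : small K [set: option kappa] by apply: small_option => //; exact: small_setT.
have smod t : small K (mod t).
  elim: t => [u|u f IH] /=; first by case: (hlP _ sX0).
  have sX : small K (X0 `|` \bigcup_(c in [set: option kappa])
                              (mod (f c) `|` range (re (mod (f c))))).
    apply: small_setU => //; apply: small_bigcup => // c _.
    by apply: small_setU => //; exact: small_tuple.
  by case: (hlP _ sX).
have supP f : [/\ tarski_vaught (mod (sup f)), X0 `<=` mod (sup f) &
    forall c, (mod (f c) `|` range (re (mod (f c)))) `<=` mod (sup f)].
  have sX : small K (X0 `|` \bigcup_(c in [set: option kappa])
                              (mod (f c) `|` range (re (mod (f c))))).
    apply: small_setU => //; apply: small_bigcup => // c _.
    by apply: small_setU => //; exact: small_tuple.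
  have [_ tv sub] := hlP _ sX; split=> // [x X0x|c x fcx]; apply: sub; first by left.
  by right; exists c.
pose B := \bigcup_(t in [set: tr]) mod t.
have sB : small K B.
  apply: small_bigcup => //; apply: small_tree => //;
    exact/(small_finite Kin)/finite_finset.
have modB t : mod t `<=` B by move=> x tx; exists t.
pose d := re B.
have LdB : limit F B b d by exact: reP.
(* Local character for d is transported from d0 by an automorphism s. *)
have [s [sAut _] sd] : exists2 s, automorphism_over set0 s & s \o d0 = d.
  by apply: limit_conjugate (reP _ s0) (limit_sub _ LdB).
have [s' [s'Aut sK s'K]] := automorphism_inverse sAut.
have [B0 [B0B B0kappa R0d0]] := loc _ (small_image s' sB).
have ss'B : s @` (s' @` B) = B.
  apply/seteqP; split=> [_ [_ [x Bx <-] <-]|x Bx]; first by rewrite s'K.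
  by exists (s' x); [exists x|exact: s'K].
have sB1B : s @` B0 `<=` B by rewrite -[X in _ `<=` X]ss'B => _ [x /B0B B0x <-]; exists x.
have R0d : R0 (range d) (s @` B0) B.
  rewrite -ss'B -sd -[X in R0 X](image_comp d0 s setT).
  apply: automorphism_invariant => //; first exact: small_tuple.
    exact: small_sub B0B (small_image _ sB).
  exact: small_image.
have [f [_ finj]] : exists f : U -> option kappa,
    (forall x, (s @` B0) x -> [set: option kappa] (f x)) /\
    forall x x', (s @` B0) x -> (s @` B0) x' -> f x = f x' -> x = x'.
  apply: (card_le_set_inj None); apply: card_le_trans (card_image_le _ _) _.
  apply: card_le_trans B0kappa.1 _.
  apply: (@card_le_trans _ _ _ [set: kappa]).
    by move: (card_setT kappa); rewrite card_eq_le => /andP[].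
  by apply: (set_inj_card_le (f := some)) => // x x' _ _ [].
(* The children of one node cover the base; the branch None ensures that every
   node has at least one child. *)
have /choice[g gP] : forall c, exists t, forall y, (s @` B0) y -> f y = c -> mod t y.
  move=> c; case: (pselect (exists2 y, (s @` B0) y & f y = c)) => [[y By fy]|ny].
    have [t _ ty] := sB1B y By; exists t => z Bz fz.
    by rewrite (finj z y) // fz fy.
  by exists (Leaf _ _ tt) => y By fy; case: ny; exists y.
pose t j : tr := iter j (fun u => sup (fun=> u)) (sup g).
have tS j : (mod (t j) `|` range (re (mod (t j)))) `<=` mod (t j.+1).
  by have [_ _ /(_ None)] := supP (fun=> t j).
have tle i j : i <= j -> mod (t i) `<=` mod (t j).
  move=> /subnK <-; elim: (j - i) => [//|k IH] x tx.
  by apply: (tS (k + i)); left; exact: IH.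
have tlt i j : i < j -> range (re (mod (t i))) `<=` mod (t j).
  by move=> ij x ex; apply: (tle i.+1 j ij); apply: tS; right.
exists (fun j => mod (t j)), (fun j => re (mod (t j))).
have [tv X0t gt] := supP g.
split=> //.
split=> [i j|j|j]; [exact: tlt|exact: (reP _ (smod _))|].
have sE : small K (\bigcup_(i in `I_j) range (re (mod (t i)))).
  by apply: small_bigcup => [//||i _]; [exact/(small_finite Kin)/finite_II|exact: small_tuple].
have EB : \bigcup_(i in `I_j) range (re (mod (t i))) `<=` mod (t j).
  by move=> x [i /= ij ix]; exact: tlt ij _ ix.
have R0M : R0 (range d) (mod (t 0)) (\bigcup_(i in `I_j) range (re (mod (t i)))).
  apply: (R0mon _ _ _ B) => //; first exact: small_tuple.
  rewrite setUidr; last by move=> x /EB; exact: modB.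
  apply: (R0base _ (s @` B0)) => //; first exact: small_tuple.
    exact: small_sub sB1B sB.
  by move=> y By; apply: (gt (f y)); left; exact: gP.
(* Both d and the j-th term are limits over the j-th model, which contains the
   earlier terms. *)
have [r rM rd] : exists2 r, automorphism_over (mod (t j)) r & r \o d = re (mod (t j)).
  apply: limit_conjugate (limit_sub (modB _) LdB) (reP _ (smod _)) => //.
rewrite -rd.
have := automorphism_invariant R0inv (small_tuple d) (smod _) sE rM.1 R0M.
rewrite (automorphism_over_image rM EB) (automorphism_over_image rM (tle 0 j (leq0n j))).
by rewrite image_comp.
Qed.

Lemma free_ultrafilter : exists F : set_system nat,
  UltraFilter F /\ forall N, F [set i | N <= i].
Proof.
have [F [FU oF]] := ultraFilterLemma eventually_filter.
by exists F; split=> // N; apply: oF; exists N.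
Qed.

(** The model depends on the sequence that witnesses dividing, so the parameters
    of [q] need not have the type of e_0 over it; they have it over C, whence
    the automorphism [r]. *)
Lemma dividing_sequence (R0 : indep_relation U) (C : set U) I (q : iformula U I) :
  invariant_relation K R0 -> right_monotonicity K R0 ->
  right_base_monotonicity K R0 -> local_character K R0 ->
  small K C -> divides C q ->
  exists (M : set U) (e : nat -> 'I_(npar (pform q)) -> U) (r : U -> U),
    [/\ small_model K M, C `<=` M,
        automorphism_over C r /\ r \o e 0 = @params _ _ _ q,
        forall j, exists2 s, automorphism_over M s & s \o e 0 = e j &
        (forall j, R0 (range (e j)) M (\bigcup_(i in `I_j) range (e i))) /\
        exists k, ~ exists x : I -> U, forall j, j < k -> psat x (e j)].
Proof.
move=> R0inv R0mon R0base R0loc sC [k [b [btp incb]]].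
have [pt] := carrier_inhabited U; have [F [FU Foo]] := free_ultrafilter.
pose X0 := C `|` ((\bigcup_(i in [set: nat]) range (b i)) `|` [set pt]).
have sX0 : small K X0.
  do 2 (apply: small_setU => //); last exact/(small_finite Kin)/finite_set1.
  by apply: small_bigcup => [//||i _]; [exact/(small_countable Kin)/countableP|exact: small_tuple].
have [M [e [sM tvM X0M Mle [eM Le R0e]]]] :=
  independent_chain b R0inv R0mon R0base R0loc FU sX0.
have CM : C `<=` M 0 by move=> x Cx; apply: X0M; left.
have [r rC re] : exists2 r, automorphism_over C r & r \o e 0 = @params _ _ _ q.
  apply: (conjugate Kin Uhom sC) => P dP Pe.
  have [i /= Pbi] := filter_ex ((limitP FU (limit_sub CM (Le 0)) dP).1 Pe).
  apply: contrapT => nP.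
  have [q' Cq' q'P] := definable_iformula (definable_not dP).
  have : isat q' (b i) by apply: btp; split=> //; exact/q'P.
  by move/q'P.
exists (M 0), e, r; split=> //.
- by split=> //; exact: tarski_vaught_elementary.
- by move=> j; apply: limit_conjugate (Le 0) (limit_sub (Mle _ _ (leq0n j)) (Le j)).
- split=> //; exists k; apply: (@limit_inconsistent _ _ _ _ _ _ b e M FU Foo _ eM _ Le incb).
    move=> j i x bx; apply/(Mle _ _ (leq0n j))/X0M; right; left.
    by exists i.
  by move=> j; exists pt; apply/(Mle _ _ (leq0n j))/X0M; right; right.
Qed.

End Chain.

(** * Amalgamation along an independent sequence *)

Section Amalgamation.
Variables (L : language) (K : Type) (U : structure L).
Hypothesis Kin : strongly_inaccessible K.

Lemma psat_automorphism I (p : pformula L I) (x : I -> U) b s :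
  automorphism s -> psat (p := p) (s \o x) (s \o b) <-> psat x b.
Proof.
move=> sA; rewrite /psat -[X in _ <-> X](sat_automorphism _ sA).
suff -> : val_cat ((s \o x) \o @vars _ _ p) (s \o b) =
          s \o val_cat (x \o @vars _ _ p) b by [].
by apply/funext => i; rewrite /= /val_cat; case: fintype.split.
Qed.

Lemma tp_sub I (a b : I -> U) (C D : set U) :
  C `<=` D -> tp a D = tp b D -> tp a C = tp b C.
Proof.
move=> CD; wlog suff: a b / tp a D = tp b D -> tp a C `<=` tp b C.
  by move=> H e; apply/seteqP; split; apply: H.
move=> e q [Cq aq]; split=> //.
have : tp a D q by split=> // j; exact/CD/Cq.
by rewrite e => -[].
Qed.

Lemma tp_psat I (a a' : I -> U) (C : set U) (p : pformula L I) b :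
  tp a C = tp a' C -> range b `<=` C -> psat (p := p) a b -> psat a' b.
Proof.
move=> e bC ab.
have : tp a C (@IFormula L U I p b) by split=> // j; apply: bC; exists j.
by rewrite e => -[].
Qed.

(** In the step, a conjugate of [c0] that goes with e_m is amalgamated with the
    tuple obtained so far, which goes with all of e_0, ..., e_(m-1). *)
Lemma amalgamate_sequence (R0 R : indep_relation U) (M : set U) (H : Type)
    (p : pformula L H) (c0 : H -> U) (e : nat -> 'I_(npar p) -> U) :
  invariant_relation K R -> right_monotonicity K R ->
  amalgamation_over_models K R0 R ->
  small_model K M -> small K [set: H] ->
  (forall j, exists2 s, automorphism_over M s & s \o e 0 = e j) ->
  (forall j, R0 (range (e j)) M (\bigcup_(i in `I_j) range (e i))) ->
  R (range c0) M (range (e 0)) -> psat c0 (e 0) ->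
  forall m, exists c : H -> U,
    [/\ R (range c) M (\bigcup_(i in `I_m) range (e i)), tp c M = tp c0 M &
        forall j, j < m -> psat c (e j)].
Proof.
move=> Rinv Rmon amal [sM elM] sH ej R0e Rc0 pc0.
have st n (f : 'I_n -> U) : small K (range f).
  exact/small_range/(small_finite Kin)/finite_finset.
have sE m : small K (\bigcup_(i in `I_m) range (e i)).
  by apply: small_bigcup => [//||i _]; [exact/(small_finite Kin)/finite_II|exact: st].
have s0 : small K (@set0 U) by exact/(small_finite Kin)/finite_set0.
have sI n : small K [set: 'I_n] by exact/(small_finite Kin)/finite_finset.
elim=> [|m [c [Rc cM pc]]].
  exists c0; split=> //; rewrite II0 bigcup_set0.
  by apply: (Rmon _ _ _ (range (e 0))) => //; [exact: small_range|rewrite set0U].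
have [s sMs se] := ej m.
pose E := \bigcup_(i in `I_m) range (e i).
have rE : range (val : E -> U) = E.
  apply/seteqP; split=> [_ [x _ <-]|x Ex]; first exact/set_mem/(valP x).
  by exists (exist _ x (mem_set Ex)).
have Rc1 : R (range (s \o c0)) M (range (e m)).
  have := (Rinv _ _ _ (small_range c0 sH) sM (st _ (e 0)) s sMs.1).1 Rc0.
  by rewrite !image_comp se (automorphism_over_image sMs).
have tps : tp (s \o c0) M = tp c M by rewrite tp_automorphism.
have [||c' [Rc' c'1 c'2]] := amal M _ _ H (e m) (val : E -> U) (s \o c0) c
    (conj sM elM) (sI _) (small_setT (sE m)) sH tps Rc1.
- by rewrite rE.
- by rewrite rE; exact: R0e.
rewrite rE in Rc' c'2.
exists c'; split.
- suff -> : \bigcup_(i in `I_m.+1) range (e i) = range (e m) `|` E by [].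
  by rewrite IIS bigcup_setU bigcup_set1 setUC.
- rewrite (tp_sub _ c'1); first exact: tp_automorphism.
  by move=> x; left.
- move=> j; rewrite ltnS leq_eqVlt => /orP[/eqP ->|jm].
    apply: (tp_psat (esym c'1)); first by move=> x; right.
    by rewrite -se; apply/psat_automorphism; case: sMs.
  apply: (tp_psat (esym c'2)); last exact: pc.
  by move=> x ex; right; exists j.
Qed.

Lemma subset_acl (C : set U) : C `<=` acl C.
Proof.
move=> c Cc.
have [|q Cq qP] := @definable_iformula _ U C unit (fun x => x tt = c).
  by apply: (definable_eq (a := inl tt) (b := inr c)) => // u [<-].
exists q; split=> //; first exact/qP.
apply: sub_finite_set (finite_set1 c) => x /qP -> //.
Qed.

End Amalgamation.

(** * Non-forking *)

Theorem theorem4p1p26 (L : language) (T : set (sentence L)) (K : Type)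
    (U : structure L) (R0 R : indep_relation U)
    (L_countable : countable_language L)
    (T_complete : complete_theory T)
    (T_infinite : only_infinite_models T)
    (K_inaccessible : strongly_inaccessible K)
    (U_monster : monster_model T K U)
    (R0_invariant : invariant_relation K R0)
    (R0_right_mono : right_monotonicity K R0)
    (R0_base_mono : right_base_monotonicity K R0)
    (R0_local : local_character K R0)
    (R_invariant : invariant_relation K R)
    (R_left_mono : left_monotonicity K R)
    (R_right_mono : right_monotonicity K R)
    (R_amalgamation : amalgamation_over_models K R0 R) :
  forall A B C : set U, small K A -> small K B -> small K C ->
    star K (monotonisation R) A C B -> nonforking A C B.
Proof.
have Kin := K_inaccessible.
have [_ _ Usat Uhom] := U_monster.
move=> A B C sA sB sC starR [q [tpq [n [rl [q_rl rl_div]]]]].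
have div l := dividing_sequence Kin L_countable Usat Uhom R0_invariant
  R0_right_mono R0_base_mono R0_local sC (rl_div l).
(* The tuples e depend on l through the arity of their type; only the images of
   the models are chosen uniformly, and this suffices to define D. *)
have /choice[N NP] : forall l, exists N, exists M e r, N = r @` M /\
    [/\ small_model K M, C `<=` M,
        automorphism_over C r /\ r \o e 0 = @params _ _ _ (rl l),
        forall j, exists2 s, automorphism_over M s & s \o e 0 = e j &
        (forall j, R0 (range (e j)) M (\bigcup_(i in `I_j) range (e i))) /\
        exists k, ~ exists x : A -> U, forall j, j < k -> psat x (e j)].
  by move=> l; have [M [e [r HM]]] := div l; exists (r @` M), M, e, r.
pose D := (B `|` C) `|` \bigcup_(l in [set: 'I_n]) (N l `|` range (@params _ _ _ (rl l))).
have sN l : small K (N l).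
  by have [M [e [r [-> [[sM _] _ _ _ _]]]]] := NP l; exact: small_image.
have sp l : small K (range (@params _ _ _ (rl l))) by exact: small_tuple.
have sD : small K D.
  apply: small_setU => //; first exact: small_setU.
  apply: small_bigcup => [//||l _]; first exact/(small_finite Kin)/finite_finset.
  exact: small_setU.
have [A' [[s [sBC sA']] RA']] := starR D sD (fun x Bx => or_introl (or_introl Bx)).
have [s' [s'Aut sK s'K]] := automorphism_inverse sBC.1.
have s'BC : automorphism_over (B `|` C) s'.
  by split=> // x BCx; rewrite -[in LHS](sBC.2 x BCx).
pose c0 : A -> U := s' \o val.
have rc0 : range c0 = A'.
  apply/seteqP; split=> [_ [[x /= xA] _ <-]|x A'x].
    have [y A'y sy] : (s @` A') x by rewrite sA'; exact: set_mem.
    by rewrite /c0 /= -sy sK.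
  have Asx : s x \in A by rewrite inE -sA'; exists x.
  by exists (exist _ (s x) Asx) => //; rewrite /c0 /= sK.
have [l rlc0] : exists l, isat (rl l) c0.
  apply/q_rl/tpq => q' [BCq' q'A].
  exact: (definable_automorphism s'BC (definable_isat BCq') _).2 q'A.
have [M [e [r [Nl [[sM elM] CM [rC re] ej [R0e [k nk]]]]]]] := NP l.
(* N l lies between C and acl(CD), so monotonisation makes it a base. *)
have RN : R A' (N l) (range (@params _ _ _ (rl l))).
  have sA'' : small K A' by rewrite -rc0; apply/small_range/small_setT.
  apply: (R_right_mono _ _ _ D) => //.
  rewrite setUidr; last by move=> x px; right; exists l => //; right.
  apply: RA'.
    move=> x Cx; rewrite Nl; exists x; first exact: CM.
    by case: rC => _; apply.
  by move=> x Nx; apply: subset_acl; left; right; exists l => //; left.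
have [r' [r'Aut rK r'K]] := automorphism_inverse rC.1.
(* Back to M and e_0, along the inverse of r. *)
pose c1 : A -> U := r' \o c0.
have rc1 : r \o c1 = c0 by apply/funext => a; rewrite /c1 /= r'K.
have sAT := small_setT sA.
have Rc1 : R (range c1) M (range (e 0)).
  apply/(R_invariant _ _ _ (small_range c1 sAT) sM (small_tuple Kin (e 0)) r rC.1).
  by rewrite !image_comp rc1 re -Nl rc0.
have pc1 : psat c1 (e 0) by apply/(psat_automorphism _ _ rC.1); rewrite rc1 re.
have [c [_ _ pc]] := amalgamate_sequence Kin R_invariant R_right_mono R_amalgamation
  (conj sM elM) sAT ej R0e Rc1 pc1 k.
by apply: nk; exists c.
Qed.
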